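(* Let $N$ be a positive integer, $\mathcal{T}=\{1,\ldots,N\}$ the set of tokens, $\mathcal{X}$ the set of texts (sequences of tokens), and $\mathcal{S}\subseteq\mathcal{X}$ a set of desirable texts. Let $h:\mathcal{X}\to\mathbb{R}$ be a function with $h(x)\ge 0$ for $x\in\mathcal{S}$ and $h(x)<0$ for $x\in\mathcal{X}\setminus\mathcal{S}$, and let $\gamma\in[0,1]$. Let $x(k)\in\mathcal{X}$ be the text at time $k$ and let $P(k)\in(0,1)^N$ be the token distribution vector at time $k$, so $\sum_{t=1}^N P(k)[t]=1$. Consider the optimization problem $$\begin{aligned}\min_Q\;& D_{\mathrm{KL}}[Q\,\|\,P(k)]\\ \text{s.t. }\;& Q\ge\mathbf{0},\\ & \mathbf{1}^\top Q=1,\\ & \mathbb{P}_{t\sim C(Q)}\big[h(x(k)\oplus t)\ge\gamma h(x(k))\big]=1\end{aligned}$$ over vectors $Q\in\mathbb{R}^N$. Then the minimizer $Q(k)$ of this problem is given, for $t\in\mathcal{T}$, by $$P'(k)[t]=\begin{cases}P(k)[t], & h(x(k)\oplus t)\ge\gamma h(x(k)),\\ 0, & \text{else},\end{cases}\qquad Q(k)[t]=\frac{P'(k)[t]}{\sum_{i=1}^N P'(k)[i]}.$$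
   Context: A token is an element of $\mathcal{T}=\{1,\ldots,N\}$; a text is a sequence of tokens, and $\mathcal{X}$ is the set of all texts. The operator $\oplus$ concatenates: for $x\in\mathcal{X}$ and $t\in\mathcal{T}$, $x\oplus t\in\mathcal{X}$ is the text $x$ followed by the token $t$. For a vector $V$, $V[i]$ denotes its $i$-th element. $\mathbf{0}$ and $\mathbf{1}$ are the all-zeros and all-ones vectors in $\mathbb{R}^N$, and $Q\ge\mathbf{0}$ is meant entrywise. For a probability vector $Q$ on $\mathcal{T}$, $C(Q)$ denotes multinomial sampling from $Q$: $t\sim C(Q)$ means that $t$ is a random token with $\mathbb{P}[t=s]=Q[s]$ for every $s\in\mathcal{T}$. The Kullback-Leibler divergence is $D_{\mathrm{KL}}[Q\,\|\,P]=\sum_{t\in\mathcal{T}}Q[t]\ln\frac{Q[t]}{P[t]}$, with the convention $0\ln 0=0$. In the text-generation system, $P(k)=G(x(k))$, where $G:\mathcal{X}\to(0,1)^N$ is a token predictor (a language model followed by a softmax), so all entries of $P(k)$ are strictly positive and they sum to $1$. The time $k$ is fixed in the statement.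
   Formalization: The statement adds, for existence of the minimizer, the assumption that the problem has a feasible point; if every token t has h(x(k)⊕t) < γh(x(k)), no Q is feasible, no minimizer exists and the formula for Q(k) is 0/0. That any minimizer equals Q(k) is stated without it. *)

(* Defs.v *)
From HB Require Import structures.
From mathcomp Require Import all_boot all_order all_algebra.
From mathcomp Require Import all_classical all_reals all_analysis.
Set Implicit Arguments.
Unset Strict Implicit.
Unset Printing Implicit Defensive.
Import Order.TTheory GRing.Theory Num.Theory.
Import numFieldNormedType.Exports.
Local Open Scope classical_set_scope.
Local Open Scope ring_scope.

(* With N = n + 1 tokens (N is positive, and measurable types are pointed),
   numbered 0, ..., n instead of 1, ..., N. *)
Notation token n := 'I_n.+1.

(* Texts are the finite token sequences, the empty one included; x ⊕ t is
   rcons x t. *)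
Notation text n := (seq (token n)).

HB.instance Definition _ (n : nat) := isPointed.Build (token n) ord0.

HB.instance Definition _ (n : nat) := @isMeasurable.Build
  default_measure_display (token n) discrete_measurable discrete_measurable0
  discrete_measurableC discrete_measurableU.

Definition prob_vector (R : realType) (n : nat) (Q : 'rV[R]_n.+1) : Prop :=
  (forall t, 0 <= Q 0 t) /\ \sum_t Q 0 t = 1.

(* The law C(Q) of a token t with P[t = s] = Q[s] for every s: the discrete
   measure with mass Q[s] at s.  It is defined for probability vectors only. *)
Section multinomial.
Context (R : realType) (n : nat) (Q : 'rV[R]_n.+1) (hQ : prob_vector Q).
Local Open Scope ereal_scope.

Definition multinomial of prob_vector Q : set (token n) -> \bar R :=
  fun A => \sum_(s : token n) (Q 0 s)%:E * \d_s A.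

Local Notation CQ := (multinomial hQ).

Let multinomial0 : CQ set0 = 0.
Proof. by rewrite /multinomial big1// => s _; rewrite measure0 mule0. Qed.

Let multinomial_ge0 A : 0 <= CQ A.
Proof. by apply: sume_ge0 => s _; rewrite mule_ge0// lee_fin; case: hQ. Qed.

Let multinomial_sigma_additive : semi_sigma_additive CQ.
Proof.
move=> F mF tF mUF; rewrite /multinomial.
under eq_fun do rewrite exchange_big/=.
have Qs s : (0 <= Q 0 s)%R by case: hQ.
apply: cvg_nnesum => s _.
  by near=> m; apply: sume_ge0 => i _; rewrite mule_ge0// lee_fin.
exact: (@measure_semi_sigma_additive _ _ _ (mscale (NngNum (Qs s)) \d_s)).
Unshelve. all: by end_near. Qed.

HB.instance Definition _ := isMeasure.Build _ _ _ CQ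
  multinomial0 multinomial_ge0 multinomial_sigma_additive.

Let multinomial_setT : CQ setT = 1.
Proof.
rewrite /multinomial; under eq_bigr do rewrite diracT mule1.
by rewrite sumEFin; case: hQ => _ ->.
Qed.

HB.instance Definition _ := Measure_isProbability.Build _ _ _ CQ
  multinomial_setT.

Lemma multinomial_set1 (s : token n) : CQ [set s] = (Q 0 s)%:E.
Proof.
rewrite /multinomial (bigD1 s)//= diracE mem_set// mule1 big1 ?adde0// => t ts.
by rewrite diracE memNset ?mule0// => /= st; rewrite st eqxx in ts.
Qed.

End multinomial.

(* The conventions of the library give the summand 0 when Q[t] = 0.  The value
   is the Kullback-Leibler divergence when P is entrywise positive, which is
   assumed wherever it is used. *)
Definition KL (R : realType) (n : nat) (Q P : 'rV[R]_n.+1) : R :=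
  \sum_t Q 0 t * ln (Q 0 t / P 0 t).

Definition feasible (R : realType) (n : nat) (h : text n -> R) (gamma : R)
    (x : text n) (Q : 'rV[R]_n.+1) : Prop :=
  exists hQ : prob_vector Q,
    (multinomial hQ : probability (token n) R)
      [set t | gamma * h x <= h (rcons x t)] = 1%E.

Definition is_minimizer (R : realType) (n : nat) (h : text n -> R) (gamma : R)
    (x : text n) (P Q : 'rV[R]_n.+1) : Prop :=
  feasible h gamma x Q /\
  forall Q' : 'rV[R]_n.+1, feasible h gamma x Q' -> KL Q P <= KL Q' P.

Definition masked (R : realType) (n : nat) (h : text n -> R) (gamma : R)
    (x : text n) (P : 'rV[R]_n.+1) : 'rV[R]_n.+1 :=
  \row_t (if gamma * h x <= h (rcons x t) then P 0 t else 0).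

(* 0 if every token is masked; the problem is then infeasible. *)
Definition renormalized (R : realType) (n : nat) (P' : 'rV[R]_n.+1) : 'rV[R]_n.+1 :=
  \row_t (P' 0 t / \sum_i P' 0 i).

(* Main.v *)
(* With Z the mass of the admissible tokens and M the renormalized masked
   vector, every feasible Q satisfies KL(Q || P) = KL(Q || M) - ln Z, because
   Q vanishes off the admissible tokens.  By Gibbs' inequality KL(Q || M) is
   nonnegative and vanishes only at Q = M. *)
Require Import Defs.
From mathcomp Require Import all_boot all_order all_algebra.
From mathcomp Require Import all_classical all_reals all_analysis.
From mathcomp Require Import lra.
Set Implicit Arguments.
Unset Strict Implicit.
Unset Printing Implicit Defensive.
Import Order.TTheory GRing.Theory Num.Theory.
Local Open Scope classical_set_scope.
Local Open Scope ring_scope.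

(** The tangent bound [1 + y < expR y] for [y != 0], taken at [y = ln (r / q)] and multiplied by
    [q]; for [q = 0] the right side is 0. *)
Lemma leif_subr_mul_ln (R : realType) (q r : R) : 0 <= q -> 0 < r ->
  q - r <= q * ln (q / r) ?= iff (q == r).
Proof.
move=> q0 r0; have [<-|qr] := eqVneq q r.
  by rewrite subrr; have [->|qn0] := eqVneq q 0;
    rewrite ?mul0r ?divff// ?ln1 ?mulr0; exact/leif_refl.
suff lt_ : q - r < q * ln (q / r) by split; [exact: ltW | rewrite lt_eqF].
have [qE|qn0] := eqVneq q 0; first by rewrite qE mul0r sub0r oppr_lt0.
have q_gt0 : 0 < q by rewrite lt_def qn0.
have lnN0 : ln (r / q) != 0.
  by rewrite ln_eq0 ?divr_gt0//; apply: contra_neq qr => /divr1_eq.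
have := expR_gt1Dx lnN0; rewrite lnK ?posrE ?divr_gt0//.
rewrite -[r / q]invf_div lnV ?posrE ?divr_gt0// invf_div ltr_pdivlMr//.
by lra.
Qed.

(** Gibbs' inequality with its equality case: the termwise bounds [Q 0 t - M 0 t] add up to 0
    because both vectors have total mass 1. *)
Lemma leif_KL (R : realType) (n : nat) (Q M : 'rV[R]_n.+1) :
  prob_vector Q -> prob_vector M -> (forall t, M 0 t = 0 -> Q 0 t = 0) ->
  0 <= KL Q M ?= iff (Q == M).
Proof.
move=> [Q0 Q1] [M0 M1] QM.
have -> : 0 = \sum_t (Q 0 t - M 0 t) by rewrite sumrB Q1 M1 subrr.
have -> : (Q == M) = [forall (t | true), Q 0 t == M 0 t].
  by apply/eqP/'forall_eqP => [-> //|QE]; apply/rowP => t; exact: QE.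
(* The termwise bound needs [M 0 t] positive; where it is 0, so is [Q 0 t], and the bound reads 0 =
   0. *)
apply: leif_sum => t _; have [Mt0|Mt0] := eqVneq (M 0 t) 0.
  by rewrite Mt0 QM// subrr mul0r eqxx; exact/leif_refl.
by apply: leif_subr_mul_ln => //; rewrite lt_def Mt0 M0.
Qed.

Lemma multinomial_eq1 (R : realType) (n : nat) (Q : 'rV[R]_n.+1)
    (hQ : prob_vector Q) (A : set (token n)) :
  multinomial hQ A = 1%E <-> forall t, ~ A t -> Q 0 t = 0.
Proof.
have [Q0 Q1] := hQ.
have -> : multinomial hQ A = (\sum_t Q 0 t * \1_A t)%:E.
  by rewrite /multinomial -sumEFin; apply: eq_bigr => t _; rewrite diracE EFinM.
have Qge t : 0 <= Q 0 t * (1 - \1_A t).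
  by rewrite mulr_ge0// subr_ge0 indicE; case: (_ \in _).
(* Pass to the mass of the complement of [A]: a sum of nonnegative terms is 0 only if every term
   is. *)
have -> : \sum_t Q 0 t * \1_A t = 1 - \sum_t Q 0 t * (1 - \1_A t).
  rewrite -[X in X - _]Q1 -sumrB; apply: eq_bigr => t _; lra.
split=> [[E] t At | QA].
  have /eqP : \sum_t Q 0 t * (1 - \1_A t) = 0 by lra.
  rewrite psumr_eq0// => /allP/(_ t (mem_index_enum _))/eqP.
  by rewrite indicE memNset// subr0 mulr1.
rewrite big1 ?subr0// => t _; rewrite indicE.
by have [At|At] := pselect (A t); [rewrite mem_set// subrr mulr0|rewrite QA// mul0r].
Qed.

Lemma feasibleP (R : realType) (n : nat) (h : text n -> R) (gamma : R)
    (x : text n) (Q : 'rV[R]_n.+1) :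
  feasible h gamma x Q <->
  prob_vector Q /\ forall t, ~~ (gamma * h x <= h (rcons x t)) -> Q 0 t = 0.
Proof.
split=> [[hQ /multinomial_eq1 QA]|[hQ QA]].
  by split=> // t ht; apply: QA; exact/negP.
by exists hQ; apply/multinomial_eq1 => t /negP; exact: QA.
Qed.

Section renormalized_masked.
Context (R : realType) (n : nat) (h : text n -> R) (gamma : R) (x : text n).
Context (P : 'rV[R]_n.+1) (P_gt0 : forall t, 0 < P 0 t).

Local Notation ok t := (gamma * h x <= h (rcons x t)).
Local Notation P' := (masked h gamma x P).
Local Notation Z := (\sum_i P' 0 i).
Local Notation M := (renormalized P').

Lemma masked_ge0 t : 0 <= P' 0 t.
Proof. by rewrite mxE; case: ifP => // _; exact: ltW. Qed.

(** If [Z] were 0, positivity of [P] would leave no admissible token, and a feasible [Q] would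
    vanish everywhere. *)
Lemma sum_masked_gt0 (Q : 'rV[R]_n.+1) : feasible h gamma x Q -> 0 < Z.
Proof.
move=> /feasibleP[[Q0 Q1] QA]; rewrite lt_def sumr_ge0 ?andbT; last first.
  by move=> t _; exact: masked_ge0.
apply/negP; rewrite psumr_eq0 => [/allP Z0|t _]; last exact: masked_ge0.
have /eqP : \sum_t Q 0 t = 0; last by rewrite Q1 oner_eq0.
apply: big1 => t _; apply: QA; have := Z0 t (mem_index_enum _).
by rewrite mxE; case: ifP => // _; rewrite /= gt_eqF.
Qed.

Hypothesis Z_gt0 : 0 < Z.

Lemma renormalized_prob_vector : prob_vector M.
Proof.
split=> [t|]; first by rewrite mxE divr_ge0 ?masked_ge0// ltW.
by under eq_bigr do rewrite mxE; rewrite -mulr_suml divff// gt_eqF.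
Qed.

Lemma renormalized_eq0 t : (M 0 t == 0) = ~~ ok t.
Proof.
rewrite mxE mulf_eq0 invr_eq0 (gt_eqF Z_gt0) orbF mxE.
by case: ifP => _; rewrite ?eqxx ?gt_eqF.
Qed.

Lemma feasible_renormalized : feasible h gamma x M.
Proof.
apply/feasibleP; split; first exact: renormalized_prob_vector.
by move=> t; rewrite -renormalized_eq0 => /eqP.
Qed.

Lemma KL_renormalized (Q : 'rV[R]_n.+1) : feasible h gamma x Q ->
  KL Q P = KL Q M - ln Z.
Proof.
move=> /feasibleP[[Q0 Q1] QA].
(* Since [Q] has mass 1, [ln Z] is spread over the tokens with weights [Q 0 t]; the identity then
   holds term by term, as [M 0 t = P 0 t / Z] on admissible tokens. *)
rewrite -[ln Z]mul1r -Q1 mulr_suml -sumrB; apply: eq_bigr => t _.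
have [Qt0|Qt0] := eqVneq (Q 0 t) 0; first by rewrite Qt0 !mul0r subrr.
have okt : ok t by apply: contraNT Qt0 => /QA ->.
have Qt_gt0 : 0 < Q 0 t by rewrite lt_def Qt0 Q0.
have [M0 _] := renormalized_prob_vector.
have Mt_gt0 : 0 < M 0 t by rewrite lt_def renormalized_eq0 okt M0.
rewrite -mulrBr -ln_div ?posrE ?divr_gt0//.
congr (_ * ln _); rewrite [M 0 t]mxE [P' 0 t]mxE okt.
by rewrite invf_div mulrA mulrAC mulfK// gt_eqF.
Qed.

(** The inequality makes [M] a minimizer; the equality case makes it the only one. *)
Lemma leif_KL_renormalized (Q : 'rV[R]_n.+1) : feasible h gamma x Q ->
  KL M P <= KL Q P ?= iff (Q == M).
Proof.
move=> fQ; have fM := feasible_renormalized.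
have [hM _] := (feasibleP _ _ _ _).1 fM.
have [hQ QA] := (feasibleP _ _ _ _).1 fQ.
have KLM0 : 0 = KL M M.
  by apply/eqP; rewrite (leif_KL hM hM (fun=> id)).
have KLQ : 0 <= KL Q M ?= iff (Q == M).
  by apply: leif_KL => // t /eqP; rewrite renormalized_eq0 => /QA.
rewrite !KL_renormalized// -KLM0; split; first by rewrite lerD2r KLQ.
by rewrite (inj_eq (addIr _)) KLQ.
Qed.

End renormalized_masked.

(** Existence is conditional because the constraints can be contradictory: when no token is
    admissible, there is no minimizer. *)
Theorem theorem2 (R : realType) (n : nat)
    (S : set (text n)) (h : text n -> R)
    (h_in : forall y, S y -> 0 <= h y)
    (h_out : forall y, ~ S y -> h y < 0)
    (gamma : R) (hgamma : 0 <= gamma <= 1)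
    (x : text n) (P : 'rV[R]_n.+1)
    (P01 : forall t, 0 < P 0 t < 1) (Psum : \sum_t P 0 t = 1) :
  (forall Q : 'rV[R]_n.+1, is_minimizer h gamma x P Q ->
     Q = renormalized (masked h gamma x P)) /\
  ((exists Q : 'rV[R]_n.+1, feasible h gamma x Q) ->
     is_minimizer h gamma x P (renormalized (masked h gamma x P))).
Proof.
have P_gt0 t : 0 < P 0 t by case/andP: (P01 t).
split=> [Q [fQ Qmin]|[Q0 fQ0]].
  have Z_gt0 := sum_masked_gt0 P_gt0 fQ.
  have KLQ := leif_KL_renormalized P_gt0 Z_gt0 fQ.
  (* The equality case turns [Q = M] into equality of divergences; one inequality is [KLQ], the
     other is minimality of [Q] tested at [M]. *)
  apply/eqP; rewrite -KLQ eq_le KLQ /=.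
  exact/Qmin/feasible_renormalized.
have Z_gt0 := sum_masked_gt0 P_gt0 fQ0.
split=> [|Q fQ]; first exact: feasible_renormalized.
by have [] := leif_KL_renormalized P_gt0 Z_gt0 fQ.
Qed.
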